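(* Let $p=(p_n)_{n\in\mathbb{N}_0}$ and $q=(q_n)_{n\in\mathbb{N}_0}$ be sequences of non-negative real numbers, and let $t_0\in(0,\infty]$ be such that the power series $$u(t)=\sum_{n=1}^\infty p_nt^n,\qquad v(t)=\sum_{n=0}^\infty q_nt^n$$ converge to finite values for all $t\in[0,t_0)$. Assume that $p_0=0$, $v\not\equiv0$ and $\lim_{t\uparrow t_0}u(t)=\infty$ (so that $u:[0,t_0)\to[0,\infty)$ is a bijection). Let $b_n$, $B$, $h_n$ ($n\in B$) and, for $\theta\in(0,t_0)$, $w_\theta$ be defined from $p,q$ as in the context. Then: for each $\theta\in(0,t_0)$, $w_\theta$ is a probability mass function with support $B$; and for every real $\delta\neq0$, with $\theta:=u^{-1}(|\delta|)$, the following holds. Let $X$ be a standard normal random variable; for each $n\in B$ let $Y_n$ be a random variable with density $h_n$, and let $N$ be a $B$-valued random variable with probability mass function $w_\theta$ that is independent of the family $(Y_n)_{n\in B}$. Then $$(X+\delta)^2\;=_{\mathcal D}\;Y_N.$$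
   Context: $\mathbb{N}=\{1,2,\ldots\}$, $\mathbb{N}_0=\{0,1,2,\ldots\}$; $=_{\mathcal D}$ denotes equality in distribution. For $k\in\mathbb{N}$, $g_k$ denotes the density on $(0,\infty)$ of the central chi-squared distribution with $k$ degrees of freedom; in particular $g_{2k+1}(x)=\dfrac{1}{2^{k+1/2}\,\Gamma(k+1/2)}\,x^{k-1/2}e^{-x/2}$, $x>0$, $k\in\mathbb{N}_0$. For $k\in\mathbb{N}$ and $n\ge k$ put $$p_n^{*k}:=\sum_{\substack{(j_1,\dots,j_k)\in\mathbb{N}^k\\ j_1+\cdots+j_k=n}}p_{j_1}\cdots p_{j_k},$$ so that $u^k(t)=\sum_{n=k}^\infty p_n^{*k}t^n$; further $p_0^{*0}:=1$ and $p_j^{*0}:=0$ for $j\in\mathbb{N}$. Here $u^k(t)=(u(t))^k$. Definitions: $$b_n:=\sum_{k=0}^{\lfloor n/2\rfloor}\Bigl(\sum_{\ell=2k}^{n}p_\ell^{*2k}q_{n-\ell}\Bigr)\frac{1}{k!\,2^k},\quad n\in\mathbb{N}_0,\qquad B:=\{n\in\mathbb{N}_0:\ b_n>0\},$$ $$h_n(x):=b_n^{-1}\sum_{k=0}^{\lfloor n/2\rfloor}\Bigl(\sum_{\ell=2k}^{n}p_\ell^{*2k}q_{n-\ell}\Bigr)\frac{1}{k!\,2^k}\,g_{2k+1}(x),\quad x>0,\ n\in B,$$ $$w_\theta(n):=\frac{1}{v(\theta)}\exp\bigl(-u^2(\theta)/2\bigr)\,b_n\,\theta^n,\quad n\in\mathbb{N}_0,\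 \theta\in(0,t_0).$$ Each $h_n$, $n\in B$, is a probability density on $(0,\infty)$. *)

(* Defs.v *)
From HB Require Import structures.
From mathcomp Require Import all_boot all_order all_algebra.
From mathcomp Require Import all_classical all_reals all_analysis.

Set Implicit Arguments.
Unset Strict Implicit.
Unset Printing Implicit Defensive.
Import Order.TTheory GRing.Theory Num.Theory.
Import numFieldNormedType.Exports.

Local Open Scope classical_set_scope.
Local Open Scope ring_scope.

Section PowerSeries.
Variable R : realType.
Implicit Types p q : nat -> R.

Definition u p (t : R) : R := limn (fun m => \sum_(1 <= n < m) p n * t ^+ n).

Definition v q (t : R) : R := limn (fun m => \sum_(0 <= n < m) q n * t ^+ n).

(* The interval [0, t0), where t0 may be +oo. *)
Definition dom (t0 : \bar R) : set R := [set t | 0 <= t /\ (t%:E < t0)%E].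

(* The filter of t tending to t0 from below, where t0 may be +oo; the value at -oo is
   junk. *)
Definition at_left_ereal (t0 : \bar R) : set_system R :=
  if t0 is r%:E then r^'- else pinfty_nbhs R.

(* The inverse of u : [0, t0) -> [0, oo). *)
Definition u_inv p (t0 : \bar R) : R -> R := 'pinv_(fun=> 0) (dom t0) (u p).

(* The indices j_i are positive, and at most n since they sum up to n. For
   k = 0 the only index is the empty tuple, whence p_0^{*0} = 1 and
   p_n^{*0} = 0 for n > 0. *)
Definition convpow p (k n : nat) : R :=
  \sum_(j : {ffun 'I_k -> 'I_n.+1} |
        [forall i, (0 < j i)%N] && (\sum_(i < k) j i == n)%N)
    \prod_(i < k) p (j i).

Definition coef p q (n k : nat) : R :=
  (\sum_((2 * k)%N <= l < n.+1) convpow p (2 * k) l * q (n - l)%N)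
  * (k`!%:R * 2 ^+ k)^-1.

Definition b p q (n : nat) : R := \sum_(0 <= k < (n %/ 2).+1) coef p q n k.

Definition B p q : set nat := [set n | 0 < b p q n].

Definition Gamma (s : R) : R :=
  \int[lebesgue_measure]_(x in `]0, +oo[) (x `^ (s - 1) * expR (- x)).

(* Meaningful for 0 < x only. *)
Definition chi2_pdf (k : nat) (x : R) : R :=
  (2 `^ (k%:R / 2) * Gamma (k%:R / 2))^-1
  * x `^ (k%:R / 2 - 1) * expR (- x / 2).

Definition h p q (n : nat) (x : R) : R :=
  (b p q n)^-1
  * \sum_(0 <= k < (n %/ 2).+1) coef p q n k * chi2_pdf (2 * k + 1) x.

Definition w p q (theta : R) (n : nat) : R :=
  (v q theta)^-1 * expR (- (u p theta) ^+ 2 / 2) * b p q n * theta ^+ n.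

Definition is_pmf (f : nat -> R) :=
  (forall n, 0 <= f n) /\ (\sum_(0 <= n <oo) (f n)%:E = 1)%E.

Definition pmf_support (f : nat -> R) : set nat := [set n | f n != 0].

End PowerSeries.

Section RandomVariables.
Variable R : realType.

(* [f] is a density on (0, oo); its values outside (0, oo) are irrelevant. *)
Definition has_density_pos (d : measure_display) (T : measurableType d)
    (P : probability T R) (Y : {RV P >-> R}) (f : R -> R) :=
  forall A : set R, measurable A ->
    distribution P Y A
    = (\int[lebesgue_measure]_(x in A `&` `]0%R, +oo[) (f x)%:E)%E.

Definition has_pmf (d : measure_display) (T : measurableType d)
    (P : probability T R) (N : {RV P >-> nat}) (f : nat -> R) :=
  forall n : nat, distribution P N [set n] = (f n)%:E.

Definition standard_normal (d : measure_display) (T : measurableType d)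
    (P : probability T R) (X : {RV P >-> R}) :=
  forall A : set R, measurable A -> distribution P X A = normal_prob 0 1 A.

(* Independence of the sigma-algebra of N and the sigma-algebra generated by
   all the Y_n, n in D. *)
Definition indep_of_family (d : measure_display) (T : measurableType d)
    (P : probability T R) (N : {RV P >-> nat}) (D : set nat)
    (Y : nat -> {RV P >-> R}) :=
  forall E F : set T,
    preimage_set_system setT N measurable E ->
    <<s \bigcup_(n in D) preimage_set_system setT (Y n) measurable >> F ->
    (P (E `&` F) = P E * P F)%E.

(* Measurability is part of the definition, so that both laws make sense. *)
Definition eq_in_distribution
    (d1 : measure_display) (T1 : measurableType d1) (P1 : probability T1 R)
    (d2 : measure_display) (T2 : measurableType d2) (P2 : probability T2 R)
    (X1 : T1 -> R) (X2 : T2 -> R) :=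
  [/\ measurable_fun setT X1, measurable_fun setT X2 &
      forall A : set R, measurable A ->
        pushforward P1 X1 A = pushforward P2 X2 A].

End RandomVariables.

(* Main.v *)
Require Import Defs.
From HB Require Import structures.
From mathcomp Require Import all_boot all_order all_algebra.
From mathcomp Require Import all_classical all_reals all_analysis.
From mathcomp Require Import measurable_realfun ring lra zify.

Set Implicit Arguments.
Unset Strict Implicit.
Unset Printing Implicit Defensive.
Import Order.TTheory GRing.Theory Num.Theory.
Import numFieldNormedType.Exports.

Local Open Scope classical_set_scope.
Local Open Scope ring_scope.

(** Write U for u(theta) and V for v(theta).  The number [convpow p k n] is the
    n-th coefficient of the k-th power of u, so that multiplying by the series of
    v and summing over n first gives, for every nonnegative sequence G,
    <<
      sum_n theta^n sum_k coef n k * G k = V * sum_k (U^2 / 2)^k / k! * G k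
    >>
    ([nneseries_coef]).  With G = 1 the right-hand side is V exp(U^2 / 2), which
    is the normalization of the weights w(n) ([is_pmf_w]).  With G k the
    chi-squared density g_(2k+1) at x it says that the mixture of the h_n with
    weights w(n) has density
    <<
      exp(- U^2 / 2) * sum_k (U^2 / 2)^k / k! * g_(2k+1)(x),
    >>
    a Poisson mixture of central chi-squared densities that depends on p, q and
    theta through U only ([nneseries_wh]).

    This density is the one of (X + delta)^2 when U = |delta|, that is, the
    noncentral chi-squared density with one degree of freedom.  Indeed
    Gamma(k + 1/2) = (2k)! sqrt(pi) / (4^k k!) ([Gamma_half_odd]) makes the sum
    over k a multiple of the power series of cosh(delta sqrt(x)), whose two
    exponentials are the contributions of the two square roots of x to the
    density of (X + delta)^2 ([nneseries_chi2_mixture]).  The Gamma values and the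
    law of (X + delta)^2 ([integral_sqr_normal]) both need the substitution
    x = y^2 for integrands that are singular at 0 or merely measurable; it is
    obtained from the uniqueness of the Lebesgue measure
    ([ge0_change_of_variables], [ge0_integral_sqr]).

    On the probabilistic side, the event that Y_N lies in A is the disjoint union
    over n of the events that N = n and Y_n lies in A; independence gives each of
    them the probability w(n) times the integral of h_n over A, and monotone
    convergence brings the sum under the integral ([mixture_distribution]).

    Finally u is a bijection from [0, t0) onto [0, +oo): it is strictly increasing
    because some p_n with n > 0 is positive, continuous as a locally uniform limit
    of polynomials, and unbounded ([u_set_bij]). *)

(** * Generating functions of the convolution powers *)

Section Convpow.
Variable R : realType.
Implicit Types p q : nat -> R.

(** Tonelli for the triangle i <= n: after exchanging the two sums, the inner one
    runs over n >= i and is a shifted copy of the series of b. *)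
Lemma nneseries_cauchy_product (a b : nat -> R) (s t : R) :
  (forall n, 0 <= a n) -> (forall n, 0 <= b n) ->
  (\sum_(0 <= n <oo) (a n)%:E = s%:E)%E ->
  (\sum_(0 <= n <oo) (b n)%:E = t%:E)%E ->
  (\sum_(0 <= n <oo) (\sum_(i < n.+1) a i * b (n - i)%N)%:E = (s * t)%:E)%E.
Proof.
move=> a0 b0 sa sb.
pose c (i n : nat) := if (i <= n)%N then (a i * b (n - i)%N)%:E else 0%E.
have c0 i n : (0 <= c i n)%E by rewrite /c; case: ifP => // _; rewrite lee_fin mulr_ge0.
transitivity (\sum_(0 <= n <oo) \sum_(0 <= i <oo) c i n)%E.
  apply: eq_eseriesr => n _.
  rewrite (nneseries_split 0 n.+1)//= add0n.
  rewrite [X in (_ + X)%E]eseries0 ?adde0; last first.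
    by move=> i ni _; rewrite /c leqNgt ni.
  rewrite big_mkord -sumEFin; apply: eq_bigr => i _.
  by rewrite /c -ltnS ltn_ord.
rewrite (nneseries_interchange xpredT xpredT)//.
transitivity (\sum_(0 <= i <oo) (t%:E * (a i)%:E))%E; last first.
  by rewrite nneseriesZl ?sa -?EFinM 1?mulrC// => i _; rewrite lee_fin.
apply: eq_eseriesr => i _.
rewrite (nneseries_split 0 i)//= add0n big_nat big1 ?add0e; last first.
  by move=> j /andP[_ ji]; rewrite /c leqNgt ji.
rewrite muleC -sb -nneseriesZl; last by move=> j _; rewrite lee_fin.
rewrite -(nneseries_addn i)//.
by apply: eq_eseriesr => j _; rewrite /c leq_addl addnK EFinM.
Qed.

(** Expanding a power of a truncation of the generating polynomial distributes
    the product over all index tuples.  The tuples with a zero entry, excluded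
    in [convpow], contribute nothing here because p 0 = 0. *)
Lemma convpow_coef p k n : p 0%N = 0 ->
  convpow p k n = ((\poly_(i < n.+1) p i) ^+ k)`_n.
Proof.
move=> p0.
rewrite -[k in RHS]card_ord -prodr_const poly_def bigA_distr_bigA/= coef_sum.
rewrite /convpow [LHS]big_mkcond; apply: eq_bigr => f _ /=.
have -> : \prod_i (p (f i) *: 'X^(f i)) =
    (\prod_i p (f i)) *: 'X^(\sum_i f i) :> {poly R}.
  rewrite -prodrXr -scaler_prod//.
rewrite coefZ coefXn [n == _]eq_sym.
case: (\sum_(i < k) f i == n)%N; last by rewrite andbF mulr0.
rewrite andbT mulr1; case: ifPn => // /forallPn[i].
by rewrite -eqn0Ngt => /eqP fi0; rewrite (bigD1 i)//= fi0 p0 mul0r.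
Qed.

(** The truncation order in [convpow_coef] depends on n; this makes it
    immaterial, so that coefficients of different order can be compared. *)
Lemma coef_exp_truncation p k n m : (n <= m)%N ->
  ((\poly_(i < m.+1) p i) ^+ k)`_n = ((\poly_(i < n.+1) p i) ^+ k)`_n.
Proof.
elim: k n m => [|k ih] n m nm; first by rewrite !expr0.
rewrite !exprS !coefM; apply: eq_bigr => i _; rewrite !coef_poly.
have -> : (i < m.+1)%N by rewrite (leq_trans (ltn_ord i)).
rewrite ltn_ord ih 1?(leq_trans (leq_subr _ _))//.
by rewrite [in RHS]ih// leq_subr.
Qed.

Lemma convpow0 p n : p 0%N = 0 -> convpow p 0 n = (n == 0%N)%:R.
Proof. by move=> p0; rewrite convpow_coef// expr0 coef1. Qed.

Lemma convpowS p k n : p 0%N = 0 ->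
  convpow p k.+1 n = \sum_(i < n.+1) p i * convpow p k (n - i).
Proof.
move=> p0; rewrite convpow_coef// exprS coefM; apply: eq_bigr => i _.
by rewrite coef_poly ltn_ord convpow_coef// coef_exp_truncation// leq_subr.
Qed.

Lemma convpow_ge0 p k n : (forall n, 0 <= p n) -> 0 <= convpow p k n.
Proof. by move=> p_ge0; apply: sumr_ge0 => f _; exact: prodr_ge0. Qed.

Lemma convpow_small p k n : p 0%N = 0 -> (n < k)%N -> convpow p k n = 0.
Proof.
move=> p0; elim: k n => // k ih n nk; rewrite convpowS// big1// => i _.
have [i0|i0] := posnP i; first by rewrite i0 p0 mul0r.
by rewrite ih ?mulr0//; have := ltn_ord i; lia.
Qed.

Lemma nneseries_convpow p (t U : R) k : p 0%N = 0 -> (forall n, 0 <= p n) ->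
  0 <= t -> (\sum_(0 <= n <oo) (p n * t ^+ n)%:E = U%:E)%E ->
  (\sum_(0 <= n <oo) (convpow p k n * t ^+ n)%:E = (U ^+ k)%:E)%E.
Proof.
move=> p0 p_ge0 t0 sU; elim: k => [|k ih].
  rewrite (@nneseriesD1 _ _ 0%N)//; last first.
    by move=> n _; rewrite lee_fin mulr_ge0 ?convpow_ge0 ?exprn_ge0.
  rewrite eseries0 ?convpow0//= ?expr0 ?mulr1 ?adde0// => n _ n0.
  by rewrite convpow0// (negbTE n0) mul0r.
rewrite exprS -(nneseries_cauchy_product _ _ sU ih); last 2 first.
  by move=> n; rewrite mulr_ge0 ?exprn_ge0.
  by move=> n; rewrite mulr_ge0 ?convpow_ge0 ?exprn_ge0.
apply: eq_eseriesr => n _; rewrite convpowS// mulr_suml; congr EFin.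
apply: eq_bigr => i _.
have -> : t ^+ n = t ^+ i * t ^+ (n - i) by rewrite -exprD subnKC// -ltnS.
by rewrite mulrACA.
Qed.

Lemma nneseries_convpowM p q (t U V : R) k : p 0%N = 0 ->
  (forall n, 0 <= p n) -> (forall n, 0 <= q n) -> 0 <= t ->
  (\sum_(0 <= n <oo) (p n * t ^+ n)%:E = U%:E)%E ->
  (\sum_(0 <= n <oo) (q n * t ^+ n)%:E = V%:E)%E ->
  (\sum_(0 <= n <oo)
    ((\sum_(k <= l < n.+1) convpow p k l * q (n - l)%N) * t ^+ n)%:E =
   (U ^+ k * V)%:E)%E.
Proof.
move=> p0 p_ge0 q_ge0 t0 sU sV.
rewrite -(nneseries_cauchy_product _ _ (nneseries_convpow k p0 p_ge0 t0 sU) sV).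
- apply: eq_eseriesr => n _; congr EFin.
  rewrite mulr_suml -(big_mkord xpredT
    (fun i => convpow p k i * t ^+ i * (q (n - i)%N * t ^+ (n - i)))).
  have -> : \sum_(0 <= i < n.+1) convpow p k i * t ^+ i * (q (n - i)%N * t ^+ (n - i))
    = \sum_(0 <= i < n.+1) convpow p k i * q (n - i)%N * t ^+ n.
    apply: eq_big_nat => i /andP[_ ni].
    have -> : t ^+ n = t ^+ i * t ^+ (n - i) by rewrite -exprD subnKC// -ltnS.
    by rewrite mulrACA.
  have [kn|kn] := leqP k n.+1.
    rewrite [RHS](big_cat_nat (leq0n k) kn)//= [X in _ = X + _]big_nat_cond.
    rewrite [X in _ = X + _]big1 ?add0r//.
    by move=> i /andP[/andP[_ ik] _]; rewrite convpow_small// !mul0r.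
  rewrite big_geq ?(ltnW kn)// big_nat_cond big1// => i /andP[/andP[_ ik] _].
  by rewrite convpow_small ?mul0r//; exact: ltn_trans ik kn.
- by move=> n; rewrite mulr_ge0 ?convpow_ge0 ?exprn_ge0.
- by move=> n; rewrite mulr_ge0 ?exprn_ge0.
Qed.

Lemma coef_ge0 p q n k : (forall n, 0 <= p n) -> (forall n, 0 <= q n) ->
  0 <= coef p q n k.
Proof.
move=> p_ge0 q_ge0; rewrite mulr_ge0 ?invr_ge0 ?mulr_ge0 ?exprn_ge0//.
by apply: sumr_ge0 => l _; rewrite mulr_ge0 ?convpow_ge0.
Qed.

(** The common source of the normalization of the weights (G = 1) and of the
    mixture density (G k the chi-squared density with 2 k + 1 degrees of
    freedom): summing over n first turns the coefficients into those of
    U ^ (2 k) V. *)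
Lemma nneseries_coef p q (t U V : R) (G : nat -> R) : p 0%N = 0 ->
  (forall n, 0 <= p n) -> (forall n, 0 <= q n) -> 0 <= t ->
  (forall k, 0 <= G k) ->
  (\sum_(0 <= n <oo) (p n * t ^+ n)%:E = U%:E)%E ->
  (\sum_(0 <= n <oo) (q n * t ^+ n)%:E = V%:E)%E ->
  (\sum_(0 <= n <oo)
    ((\sum_(0 <= k < (n %/ 2).+1) coef p q n k * G k) * t ^+ n)%:E =
   V%:E * \sum_(0 <= k <oo) ((U ^+ 2 / 2) ^+ k / k`!%:R * G k)%:E)%E.
Proof.
move=> p0 p_ge0 q_ge0 t0 G0 sU sV.
have V0 : 0 <= V.
  rewrite -lee_fin -sV; apply: nneseries_ge0 => n _ _.
  by rewrite lee_fin mulr_ge0 ?exprn_ge0.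
pose c n k := (coef p q n k * G k * t ^+ n)%:E.
have c0 n k : (0 <= c n k)%E.
  by rewrite lee_fin mulr_ge0 ?exprn_ge0//; apply: mulr_ge0 => //; exact: coef_ge0.
transitivity (\sum_(0 <= n <oo) \sum_(0 <= k <oo) c n k)%E.
  apply: eq_eseriesr => n _.
  rewrite (nneseries_split 0 (n %/ 2).+1)//= add0n.
  rewrite [X in (_ + X)%E]eseries0 ?adde0; last first.
    move=> k nk _; rewrite /c /coef big_geq ?mul0r// mulnC -ltn_divLR//.
  by rewrite mulr_suml sumEFin.
rewrite (nneseries_interchange xpredT xpredT)//.
rewrite -nneseriesZl; last first.
  by move=> k _; rewrite lee_fin mulr_ge0// divr_ge0// exprn_ge0// divr_ge0// sqr_ge0.
apply: eq_eseriesr => k _.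
have := nneseries_convpowM (2 * k) p0 p_ge0 q_ge0 t0 sU sV.
move=> /(congr1 (fun z => ((k`!%:R * 2 ^+ k)^-1 * G k)%:E * z))%E.
rewrite -nneseriesZl; last first.
  move=> n _; rewrite lee_fin mulr_ge0 ?exprn_ge0//.
  by apply: sumr_ge0 => l _; rewrite mulr_ge0 ?convpow_ge0.
have -> : (((k`!%:R * 2 ^+ k)^-1 * G k)%:E * (U ^+ (2 * k) * V)%:E =
  V%:E * ((U ^+ 2 / 2) ^+ k / k`!%:R * G k)%:E)%E.
  by rewrite -!EFinM exprM expr_div_n invfM; congr EFin; ring.
move=> <-; apply: eq_eseriesr => n _; rewrite /c /coef -EFinM; congr EFin.
ring.
Qed.

End Convpow.

(** * The generating function as a bijection *)

Section GeneratingFunctionBijection.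
Variables (R : realType) (p : nat -> R) (t0 : \bar R).
Hypothesis p_ge0 : forall n, 0 <= p n.
Hypothesis u_cvg : forall t, dom t0 t -> cvgn (fun m => \sum_(1 <= n < m) p n * t ^+ n).

Let S m (t : R) := \sum_(1 <= n < m) p n * t ^+ n.

Lemma dom_le (s t : R) : 0 <= s -> s <= t -> dom t0 t -> dom t0 s.
Proof. by move=> s0 st [_ tt0]; split => //; rewrite (le_lt_trans _ tt0)// lee_fin. Qed.

(** Each term p n * t ^ n is nondecreasing in t, so the increments of the partial
    sums over [s, t] increase to the increment of u.  Monotonicity, strict
    monotonicity and the uniform tail bound below are all instances. *)
Lemma partial_increment_le_u s t m : 0 <= s -> s <= t -> dom t0 t ->
  S m t - S m s <= u p t - u p s.
Proof.
move=> s0 st dt; have ds := dom_le s0 st dt.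
have c : S m t - S m s @[m --> \oo] --> u p t - u p s.
  by apply: cvgB; exact: u_cvg.
rewrite -(cvg_lim _ c)//.
apply: (nondecreasing_cvgn_le (u_ := fun m => S m t - S m s)); last first.
  by apply/cvg_ex; exists (u p t - u p s).
apply/nondecreasing_seqP => n; rewrite /S.
have [n0|n0] := posnP n; first by rewrite n0 !big_geq.
rewrite !big_nat_recr//= opprD addrACA lerDl -mulrBr mulr_ge0// subr_ge0.
by rewrite lerXn2r// nnegrE// (le_trans s0).
Qed.

Lemma u_at0 : u p 0 = 0.
Proof.
rewrite /u (_ : (fun _ => _) = cst 0) ?lim_cst//; apply/funext => m.
by rewrite big_nat big1// => n /andP[n0 _]; rewrite expr0n gtn_eqF// mulr0.
Qed.

Lemma u_homo s t : 0 <= s -> s <= t -> dom t0 t -> u p s <= u p t.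
Proof.
move=> s0 st dt; have := partial_increment_le_u 0 s0 st dt.
by rewrite /S !big_geq// subr0 subr_ge0.
Qed.

Lemma u_incr s t n : 0 < p n -> (0 < n)%N -> 0 <= s -> s < t -> dom t0 t ->
  u p s < u p t.
Proof.
move=> pn n0 s0 st dt; rewrite -subr_gt0.
apply: lt_le_trans (partial_increment_le_u n.+1 s0 (ltW st) dt).
rewrite /S !big_nat_recr//= opprD addrACA ltr_wpDl//; last first.
  by rewrite -mulrBr mulr_gt0// subr_gt0 ltrXn2r// -lt0n n0.
rewrite -sumrB big_nat; apply: sumr_ge0 => i _; rewrite -mulrBr mulr_ge0// subr_ge0.
apply: lerXn2r; rewrite ?nnegrE//; last exact: ltW.
exact: le_trans s0 (ltW st).
Qed.

(** On [0, K] the tail of the series is at most its tail at K: the polynomials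
    S m converge uniformly to u. *)
Lemma within_continuous_u K : dom t0 K -> {within `[0, K], continuous (u p)}.
Proof.
move=> dK; apply/subspace_continuousP => x /=; rewrite in_itv/= => /andP[x0 xK].
apply/cvgrPdist_lt => e e0.
have e2 : 0 < e / 2 by rewrite divr_gt0.
have K0 : 0 <= K by case: dK.
have /cvgrPdist_lt/(_ _ e2)[m _ /(_ _ (leqnn m))] := u_cvg dK.
rewrite -/(u p K) -/(S m K) => Km.
have tail t : 0 <= t -> t <= K -> 0 <= u p t - S m t < e / 2.
  move=> t_ge0 tK; apply/andP; split.
    have := partial_increment_le_u m (lexx 0) t_ge0 (dom_le t_ge0 tK dK).
    rewrite u_at0 subr0 (_ : S m 0 = 0) ?subr0 ?subr_ge0//.
    by rewrite /S big_nat big1// => n /andP[n0 _]; rewrite expr0n gtn_eqF// mulr0.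
  apply: le_lt_trans (le_lt_trans (ler_norm _) Km).
  by have := partial_increment_le_u m t_ge0 tK dK; lra.
have cS : continuous (S m).
  apply: continuous_big => [|n _ z]; first exact: add_continuous.
  by apply: cvgM; [exact: cvg_cst|exact: exprn_continuous].
have /cvgrPdist_lt/(_ _ e2) Sx := cS x.
rewrite /prop_near1 /within /=; apply: filterS Sx => y; rewrite in_itv/=.
move=> Sxy /andP[y0 yK].
have /andP[tx0 tx1] := tail _ x0 xK; have /andP[ty0 ty1] := tail _ y0 yK.
rewrite !ltr_norml in Sxy *; case/andP: Sxy => Sxy1 Sxy2.
rewrite -[from_subspace _ _ x]/(u p x) -[from_subspace _ _ y]/(u p y).
apply/andP; split; lra.
Qed.

Hypothesis t0_gt0 : (0 < t0)%E.
Hypothesis u_infty : u p t @[t --> at_left_ereal t0] --> +oo.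

Lemma u_unbounded y : exists2 K, dom t0 K & y <= u p K.
Proof.
move: t0_gt0 u_infty; rewrite /dom /at_left_ereal.
case: t0 => [r|_|//]; last move=> /cvgryPge/(_ y) H.
- rewrite lte_fin => r0 /cvgryPge/(_ y) H.
  near (r^'-) => K; exists K; last by near: K.
  split; first by rewrite ltW//; near: K; exact: nbhs_left_gt.
  by rewrite lte_fin; near: K; exact: nbhs_left_lt.
- near (pinfty_nbhs R) => K; exists K; last by near: K.
  split; last by rewrite ltry.
  by near: K; exact: nbhs_pinfty_ge.
Unshelve. all: by end_near. Qed.

(** Otherwise u would vanish identically. *)
Lemma p_pos_index : exists2 n, (0 < n)%N & 0 < p n.
Proof.
have [K dK] := u_unbounded 1; apply: contraPP => /forall2NP p00.
apply/negP; rewrite -ltNge /u (_ : (fun _ => _) = cst 0) ?lim_cst//.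
apply/funext => m; rewrite big_nat big1// => n /andP[n0 _].
have [//|] := p00 n; move=> /negP; rewrite -leNgt => pn.
by rewrite (@le_anti _ _ (p n) 0) ?mul0r// pn p_ge0.
Qed.

Lemma u_set_bij : set_bij (dom t0) [set y | 0 <= y] (u p).
Proof.
have [n n0 pn] := p_pos_index.
split.
- move=> t [t_ge0 tt0] /=; rewrite -u_at0; exact: u_homo.
- move=> s t /set_mem ds /set_mem dt ust.
  have [st|ts|//] := ltgtP s t.
    by have := u_incr pn n0 ds.1 st dt; rewrite ust ltxx.
  by have := u_incr pn n0 dt.1 ts ds; rewrite ust ltxx.
- move=> y /= y0; have [K dK yK] := u_unbounded y.
  have [|c /[!in_itv]/= /andP[c0 cK] <-] :=
    @IVT R (u p) 0 K y dK.1 (within_continuous_u dK).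
    by rewrite u_at0 min_l ?max_r ?y0// (le_trans y0).
  by exists c => //; exact: dom_le dK.
Qed.

End GeneratingFunctionBijection.

(** * Change of variables in Lebesgue integrals *)

Section WithDensity.
Context d (T : measurableType d) (R : realType).
Variable mu : {measure set T -> \bar R}.
Variable g : T -> R.

(** The proofs of measurability and nonnegativity are arguments so that the
    measure structure below can be attached to the definition. *)
Definition with_density (mg : measurable_fun setT g)
  (g_ge0 : forall x, 0 <= g x) : set T -> \bar R :=
  fun A => (\int[mu]_(x in A) (g x)%:E)%E.

Hypothesis mg : measurable_fun setT g.
Hypothesis g_ge0 : forall x, 0 <= g x.
Local Notation nu := (with_density mg g_ge0).

Let with_density0 : nu set0 = 0%E.
Proof. by rewrite /with_density integral_set0. Qed.

Let with_density_ge0 A : (0 <= nu A)%E.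
Proof. by apply: integral_ge0 => x _; rewrite lee_fin. Qed.

Let with_density_sigma_additive : semi_sigma_additive nu.
Proof.
move=> /= F mF tF mUF; rewrite /with_density; apply: cvg_toP.
  apply: ereal_nondecreasing_is_cvgn => m n mn.
  apply: lee_sum_nneg_natr => // k _ _.
  by apply: integral_ge0 => x _; rewrite lee_fin.
rewrite ge0_integral_bigcup//=.
- by apply/measurable_EFinP; exact: measurable_funTS.
- by move=> x _; rewrite lee_fin.
Qed.

HB.instance Definition _ := isMeasure.Build _ _ _ nu
  with_density0 with_density_ge0 with_density_sigma_additive.

Let mEg : measurable_fun setT (EFin \o g). Proof. exact/measurable_EFinP. Qed.

Let integral_with_density_indic E : measurable E ->
  (\int[nu]_x (\1_E x)%:E = \int[mu]_x ((\1_E x)%:E * (g x)%:E))%E.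
Proof.
move=> mE; rewrite integral_indic//= setIT /with_density integral_mkcond/=.
apply: eq_integral => x _; rewrite patchE indicE.
by case: (x \in E); rewrite ?mul1e ?mul0e.
Qed.

Import HBNNSimple.

Let integral_with_density_nnsfun (f : {nnsfun T >-> R}) :
  (\int[nu]_x (f x)%:E = \int[mu]_x ((f x)%:E * (g x)%:E))%E.
Proof.
under [LHS]eq_integral do rewrite fimfunE -fsumEFin//.
rewrite [LHS]ge0_integral_fsum//; last 2 first.
  - by move=> r; exact/measurable_EFinP/measurableT_comp.
  - by move=> n x _; rewrite EFinM nnfun_muleindic_ge0.
under [RHS]eq_integral.
  move=> x xD; rewrite fimfunE -fsumEFin// ge0_mule_fsuml; last first.
    by move=> r; rewrite EFinM nnfun_muleindic_ge0.
  over.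
rewrite [RHS]ge0_integral_fsum//; last 2 first.
  - move=> r; apply: emeasurable_funM => //.
    by apply/measurable_EFinP/measurableT_comp.
  - by move=> n x _; rewrite EFinM mule_ge0 ?nnfun_muleindic_ge0// lee_fin.
apply: eq_fsbigr => r _; rewrite !integralZl_indic_nnsfun//.
under [RHS]eq_integral do rewrite EFinM -muleA.
have [r0|r0] := leP 0 r.
  rewrite ge0_integralZl//; last 2 first.
  - apply: emeasurable_funM => //; exact/measurable_EFinP/measurable_indic.
  - by move=> x _; rewrite mule_ge0// lee_fin.
  by rewrite -integral_with_density_indic.
rewrite preimage_nnfun0// integral_indic//= set0I measure0 mule0.
by rewrite integral0_eq// => x _; rewrite indic0 mul0e mule0.
Qed.

Lemma ge0_integral_with_density (f : T -> \bar R) :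
  measurable_fun setT f -> (forall x, 0 <= f x)%E ->
  (\int[nu]_x f x = \int[mu]_x (f x * (g x)%:E))%E.
Proof.
move=> mf f0; pose f_ := nnsfun_approx measurableT mf.
transitivity (lim (\int[nu]_x (f_ n x)%:E @[n --> \oo])%E).
  rewrite -monotone_convergence//=.
  - apply: eq_integral => x _; apply/esym/cvg_lim => //=.
    exact: cvg_nnsfun_approx.
  - by move=> n; exact/measurable_EFinP/measurable_funTS.
  - by move=> n x _; rewrite lee_fin.
  - by move=> x _ m n mn; rewrite lee_fin; exact/lefP/nd_nnsfun_approx.
under eq_fun do rewrite integral_with_density_nnsfun.
rewrite -monotone_convergence//=.
- apply: eq_integral => x _; apply/cvg_lim => //=.
  by apply: cvgeZr => //; exact: cvg_nnsfun_approx.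
- move=> n; apply: emeasurable_funM => //.
  exact/measurable_EFinP/measurable_funTS.
- by move=> n x _; rewrite mule_ge0// lee_fin.
- move=> x _ m n mn; rewrite lee_wpmul2r ?lee_fin//.
  exact/lefP/nd_nnsfun_approx.
Qed.

End WithDensity.

Section ChangeOfVariables.
Variable R : realType.
Notation mu := (@lebesgue_measure R).

(** The pushforward under phi of the measure with density g agrees with the
    Lebesgue measure on the half-open intervals, hence everywhere.  Since f is
    only measurable, this applies to indicators of Borel sets and to integrands
    that are singular at 0. *)
Lemma ge0_change_of_variables (phi g : R -> R) (f : R -> \bar R) :
  measurable_fun setT phi -> measurable_fun setT g -> (forall x, 0 <= g x) ->
  (forall a b : R, a < b ->
    (\int[mu]_(x in phi @^-1` `]a, b]) (g x)%:E = (b - a)%:E)%E) ->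
  measurable_fun setT f -> (forall x, 0 <= f x)%E ->
  (\int[mu]_x f x = \int[mu]_x (f (phi x) * (g x)%:E))%E.
Proof.
move=> mphi mg g0 phig mf f0.
pose nu : {measure set (measurableTypeR R) -> \bar R} := with_density mu mg g0.
have mphi' : measurable_fun (setT : set (measurableTypeR R))
    (phi : _ -> measurableTypeR R) by exact: mphi.
pose phi' : {mfun measurableTypeR R >-> measurableTypeR R} :=
  HB.pack (phi : measurableTypeR R -> measurableTypeR R)
    (isMeasurableFun.Build _ _ _ _ _ mphi').
have muE A : measurable A -> mu A = pushforward nu phi' A.
  move=> mA.
  apply: (@lebesgue_measure_unique _ (pushforward nu phi')) => //= _ [[a b]] _ <-.
  rewrite /= lebesgue_measure_itv/= lte_fin /pushforward /=.
  case: ltP => [ab|ba]; first by rewrite /nu/= /with_density phig// EFinB.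
  by rewrite set_itv_ge ?bnd_simp -?leNgt// preimage_set0 measure0.
transitivity (\int[pushforward nu phi']_x f x)%E.
  by apply: (@eq_measure_integral _ (measurableTypeR R)) => A mA _; exact: muE.
rewrite ge0_integral_pushforward//= ?preimage_setT.
by rewrite (ge0_integral_with_density mu mg g0)//; exact: measurableT_comp.
Qed.

Lemma ge0_integral_shift (c : R) (f : R -> \bar R) :
  measurable_fun setT f -> (forall x, 0 <= f x)%E ->
  (\int[mu]_x f x = \int[mu]_x f (x + c)%R)%E.
Proof.
move=> mf f0.
rewrite (@ge0_change_of_variables (fun x => x + c) (cst 1) f)//.
- by apply: eq_integral => x _; rewrite mule1.
- exact: measurable_funD.
- move=> a b ab; rewrite (eq_integral (cst 1%E))// integral_cst//=; last first.
    by rewrite -[X in measurable X]setTI; exact: measurable_funD.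
  rewrite mul1e (_ : _ @^-1` _ = `]a - c, b - c]%classic); last first.
    by apply/seteqP; split=> x /=; rewrite !in_itv/= ltrBlDr lerBrDr.
  by rewrite lebesgue_measure_itv/= lte_fin ltrD2r ab -EFinB; congr EFin; ring.
Qed.

End ChangeOfVariables.

(** * The substitution x = y ^ 2 *)

Section SquareSubstitution.
Variable R : realType.
Notation mu := (@lebesgue_measure R).

(** The map y |-> y |y| extends squaring on the half-line to an increasing
    bijection of the whole line, as [ge0_change_of_variables] requires; its
    derivative 2 |y| exists also at 0. *)
Lemma is_derive_mul_norm (y : R) : is_derive y 1 (fun x => x * `|x|) (2 * `|y|).
Proof.
have [y0|y0|->] := ltgtP y 0.
- apply: (@near_eq_is_derive R R^o R^o (fun x => - x ^+ 2)).
    near=> x; rewrite ltr0_norm ?mulrN//.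
    by near: x; exact: lt_nbhsl.
  apply: is_derive_eq.
  by rewrite ltr0_norm//= /GRing.scale/=; ring.
- apply: (@near_eq_is_derive R R^o R^o (fun x => x ^+ 2)).
    near=> x; rewrite gtr0_norm//.
    by near: x; exact: lt_nbhsr.
  apply: is_derive_eq.
  by rewrite gtr0_norm//= /GRing.scale/=; ring.
- have h0 : h^-1 *: ((((fun x : R => x * `|x|) \o shift (0 : R)) (h *: (1 : R^o)) : R^o)
      - (0 : R) * `|0 : R|) @[h --> (0 : R)^'] --> (0 : R).
    have : `|h| @[h --> (0 : R)^'] --> (0 : R).
      rewrite -[X in _ --> X](@normr0 _ R); apply: cvg_within_filter.
      exact: (@norm_continuous _ R 0).
    apply: cvg_trans; apply: near_eq_cvg; near=> h.
    rewrite /= /shift /GRing.scale/= mulr1 addr0 mul0r subr0 mulrA mulVf ?mul1r//.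
    by near: h; exact: nbhs_dnbhs_neq.
  rewrite (@normr0 _ R) mulr0.
  split; first by apply/cvg_ex; exists 0.
  by apply/cvg_lim.
Unshelve. all: by end_near. Qed.

(** The inverse of y |-> y |y|. *)
Definition ssqrt (x : R) := Num.sg x * Num.sqrt `|x|.

Lemma ssqrtK x : ssqrt x * `|ssqrt x| = x.
Proof.
have [->|x0] := eqVneq x 0; first by rewrite /ssqrt sgr0 !mul0r.
rewrite /ssqrt normrM normr_sg x0 mul1r ger0_norm ?sqrtr_ge0//.
by rewrite -mulrA -expr2 sqr_sqrtr// -numEsg.
Qed.

Lemma mul_norm_lt (x y : R) : (x * `|x| < y * `|y|) = (x < y).
Proof.
have mono : {homo (fun x : R => x * `|x|) : x y / x < y}.
  move=> a b ab /=; have [a0|a0] := leP 0 a.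
    have b0 := le_trans a0 (ltW ab).
    by rewrite !ger0_norm// -!expr2 ltr_pXn2r// nnegrE.
  rewrite (ltr0_norm a0); have [b0|b0] := leP 0 b.
    rewrite (@lt_le_trans _ _ 0)//; last by rewrite mulr_ge0.
    by rewrite mulrN oppr_lt0 -expr2 exprn_even_gt0//= lt_eqF.
  by rewrite (ltr0_norm b0); nra.
have [xy|xy|->] := ltgtP x y; last by rewrite ltxx.
  exact: mono.
by apply/negbTE; rewrite -leNgt ltW// mono.
Qed.

Lemma preimage_mul_norm_itv (a b : R) :
  (fun x => x * `|x|) @^-1` `]a, b] = `]ssqrt a, ssqrt b]%classic.
Proof.
have E x : (a < x * `|x| <= b) = (ssqrt a < x <= ssqrt b).
  by rewrite -{1}[a]ssqrtK -{1}[b]ssqrtK mul_norm_lt !leNgt mul_norm_lt.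
by apply/seteqP; split=> x /=; rewrite !in_itv/= E.
Qed.

Lemma continuous_mul_norm : continuous (fun x : R => x * `|x|).
Proof. by move=> x; apply: cvgM; [exact: cvg_id|exact: norm_continuous]. Qed.

Lemma ge0_integral_mul_norm (f : R -> \bar R) :
  measurable_fun setT f -> (forall x, 0 <= f x)%E ->
  (\int[mu]_x f x = \int[mu]_x (f (x * `|x|)%R * (2 * `|x|)%:E))%E.
Proof.
have c2 : continuous (fun x : R => 2 * `|x|).
  by move=> x; apply: cvgM; [exact: cvg_cst|exact: norm_continuous].
move=> mf f0; apply: ge0_change_of_variables => //.
- exact: continuous_measurable_fun continuous_mul_norm.
- exact: continuous_measurable_fun c2.
- move=> a b ab; rewrite preimage_mul_norm_itv.
  have sab : ssqrt a < ssqrt b by rewrite -mul_norm_lt !ssqrtK.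
  rewrite integral_itv_obnd_cbnd; last first.
    apply/measurable_EFinP/measurable_funTS.
    exact: continuous_measurable_fun c2.
  rewrite (@continuous_FTC2 _ _ (fun x => x * `|x|))//.
  - by rewrite !ssqrtK EFinB.
  - exact: continuous_subspaceT.
  - split=> [x _||].
    + by have [] := is_derive_mul_norm x.
    + by apply: cvg_at_right_filter; exact: continuous_mul_norm.
    + by apply: cvg_at_left_filter; exact: continuous_mul_norm.
  - by move=> x _; rewrite derive1E; have [] := is_derive_mul_norm x.
Qed.

(** Extend f by 0 to the negative half-line, where y |-> y |y| is negative. *)
Lemma ge0_integral_sqr (f : R -> \bar R) :
  measurable_fun (`]0, +oo[%classic : set R) f ->
  (forall x, 0 < x -> (0 <= f x)%E) ->
  (\int[mu]_(x in `]0%R, +oo[) f x =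
   \int[mu]_(x in `]0%R, +oo[) (f (x ^+ 2)%R * (2 * x)%:E))%E.
Proof.
move=> mf f0.
rewrite integral_mkcond ge0_integral_mul_norm; last 2 first.
- exact/(measurable_restrictT _ _).1.
- move=> x; rewrite patchE; case: ifPn => // /[!inE]/=; rewrite in_itv/= andbT.
  exact: f0.
rewrite [RHS]integral_mkcond; apply: eq_integral => x _; rewrite !patchE.
have [x0|x0] := ltP 0 x.
  rewrite !mem_set/= ?in_itv/= ?x0 ?mulr_gt0 ?normr_gt0 ?gt_eqF//.
  by rewrite gtr0_norm// expr2.
rewrite !memNset ?mul0e//= in_itv/= andbT; apply/negP; rewrite -leNgt//.
by rewrite mulr_le0_ge0.
Qed.

End SquareSubstitution.

(** * Half-integer values of the Gamma function and chi-squared densities *)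

Section HalfIntegerGamma.
Variable R : realType.
Notation mu := (@lebesgue_measure R).

Lemma nneseries_exp (z : R) :
  (\sum_(0 <= k <oo) (z ^+ k / k`!%:R)%:E = (expR z)%:E)%E.
Proof.
apply/cvg_lim => //; under eq_fun do rewrite sumEFin.
apply/fine_cvgP; split; first by near=> n.
exact: (is_cvg_series_exp_coeff z).
Unshelve. all: by end_near. Qed.

(** The odd terms of the series of exp z and exp (- z) cancel; the even partial
    sums of their mean are the partial sums of the series of cosh. *)
Lemma nneseries_cosh (z : R) :
  (\sum_(0 <= k <oo) (z ^+ (2 * k) / (2 * k)`!%:R)%:E =
   ((expR z + expR (- z)) / 2)%:E)%E.
Proof.
have cE : (series (exp_coeff z) n + series (exp_coeff (- z)) n) / 2 @[n --> \oo]
    --> (expR z + expR (- z)) / 2.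
  by apply: cvgM; [apply: cvgD; exact: is_cvg_series_exp_coeff|exact: cvg_cst].
apply/cvg_lim => //; under eq_fun do rewrite sumEFin.
apply/fine_cvgP; split; first by near=> n.
have E n : (series (exp_coeff z) (2 * n)%N + series (exp_coeff (- z)) (2 * n)%N) / 2 =
    \sum_(0 <= k < n) z ^+ (2 * k) / (2 * k)`!%:R.
  elim: n => [|n ih]; first by rewrite muln0 /series/= !big_geq// addr0 mul0r.
  rewrite big_nat_recr//= -ih mulnSr addn2 !seriesSr/= /exp_coeff/=.
  have e : (- z) ^+ (2 * n) = z ^+ (2 * n) by rewrite !exprM sqrrN.
  have f0 m : m`!%:R != 0 :> R by rewrite pnatr_eq0 -lt0n fact_gt0.
  by rewrite !exprS e; field; rewrite !f0.
have : (fun n => (series (exp_coeff z) (2 * n)%N +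
    series (exp_coeff (- z)) (2 * n)%N) / 2) @ \oo --> (expR z + expR (- z)) / 2.
  apply: (cvg_comp (fun n => 2 * n)%N _ _ cE).
  exact: cvg_mulnl.
by under eq_fun do rewrite E.
Unshelve. all: by end_near. Qed.

(** The half-line moments of exp (- x ^ 2) of even order 2 k
    ([integral_gauss_moment]). *)
Definition gauss_moment k : R := (2 * k)`!%:R / (4 ^+ k * k`!%:R) * (Num.sqrt pi / 2).

(** The factor x * gauss_fun x has the primitive - gauss_fun x / 2.  On a bounded
    interval all terms are finite; the boundary term vanishes as n grows, by
    [expr_gauss_cvg0]. *)
Lemma gauss_moment_parts k (n : nat) : (0 < n)%N ->
  (\int[mu]_(x in `[0%R, n%:R]) (x ^+ (2 * k.+1) * gauss_fun x)%:E =
   (- (n%:R ^+ (2 * k).+1 * gauss_fun n%:R / 2))%:E +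
   ((2 * k).+1%:R / 2)%:E *
     \int[mu]_(x in `[0%R, n%:R]) (x ^+ (2 * k) * gauss_fun x)%:E)%E.
Proof.
move=> n0.
pose F (x : R) := x ^+ (2 * k).+1.
pose f (x : R) := (2 * k).+1%:R * x ^+ (2 * k).
pose G (x : R) := - (gauss_fun x / 2).
pose g (x : R) := x * gauss_fun x.
have cX m : continuous (fun x : R => x ^+ m) by exact: exprn_continuous.
have cf : continuous f.
  by move=> x; apply: cvgM; [exact: cvg_cst|exact: cX].
have cg : continuous g.
  by move=> x; apply: cvgM; [exact: cvg_id|exact: continuous_gauss_fun].
have dF (x : R) : is_derive x 1 F (f x).
  apply: DeriveDef; first exact: exprn_derivable.
  by rewrite exp_derive /= /f /GRing.scale/= mulr1.
have dG (x : R) : is_derive x 1 G (g x).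
  rewrite /G /gauss_fun; apply: is_derive_eq.
  by rewrite /g /gauss_fun /= /GRing.scale/=; field.
have LR (H h : R -> R) : (forall x : R, is_derive x 1 H (h x)) ->
    derivable_oo_LRcontinuous H 0 n%:R.
  move=> dH.
  have cH : continuous H.
    move=> x; apply: differentiable_continuous; apply/derivable1_diffP.
    by have [] := dH x.
  split; first by move=> x _; have [] := dH x.
  - by apply: cvg_at_right_filter; exact: cH.
  - by apply: cvg_at_left_filter; exact: cH.
have D (H h : R -> R) : (forall x : R, is_derive x 1 H (h x)) ->
    {in `]0, n%:R[, derive1 H =1 h}.
  by move=> dH x _; rewrite derive1E; have [] := dH x.
have := @integration_by_parts R F G f g 0 n%:R.
rewrite ltr0n => /(_ n0 (continuous_subspaceT cf) (LR _ _ dF) (D _ _ dF)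
   (continuous_subspaceT cg) (LR _ _ dG) (D _ _ dG)) H.
transitivity (\int[mu]_(x in `[0%R, n%:R]) (F x * g x)%:E)%E.
  by apply: eq_integral => x _; rewrite /F /g mulnS addSn add1n !exprS; congr EFin; ring.
rewrite H; congr (_ + _)%E.
  by rewrite /F /G (exprS 0) mul0r; congr EFin; ring.
have -> : (\int[mu]_(x in `[0%R, n%:R]) (f x * G x)%:E = \int[mu]_(x in `[0%R, n%:R])
    ((- ((2 * k).+1%:R / 2))%:E * (x ^+ (2 * k) * gauss_fun x)%:E))%E.
  apply: eq_integral => x _; rewrite /f /G -EFinM; congr EFin; ring.
rewrite integralZl//; last first.
  apply: continuous_compact_integrable; first exact: segment_compact.
  apply: continuous_subspaceT => x.
  by apply: cvgM; [exact: cX|exact: continuous_gauss_fun].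
by rewrite EFinN mulNe oppeK.
Qed.

Lemma expr_gauss_cvg0 m :
  (n%:R : R) ^+ m * gauss_fun (n%:R : R) / 2 @[n --> \oo] --> (0 : R).
Proof.
have c0 : m.+1`!%:R * n.+1%:R^-1 @[n --> \oo] --> (0 : R).
  by rewrite -(mulr0 m.+1`!%:R); apply: cvgM; [exact: cvg_cst|exact: cvg_harmonic].
rewrite -(cvg_shiftS (fun n => n%:R ^+ m * gauss_fun n%:R / 2)).
apply: (squeeze_cvgr _ (cvg_cst 0) c0); near=> n.
rewrite divr_ge0 ?mulr_ge0 ?exprn_ge0 ?gauss_fun_ge0//=.
pose y : R := n.+1%:R.
have y1 : 1 <= y by rewrite ler1n.
have y0 : 0 < y by rewrite (lt_le_trans _ y1).
rewrite -/y /gauss_fun expRN.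
(* One term of the exponential series at y ^ 2 beats y ^ m by a factor y. *)
have le1 : y ^+ m.+1 / m.+1`!%:R <= expR (y ^+ 2).
  apply: (@le_trans _ _ (1 + (y ^+ 2) ^+ m.+1 / m.+1`!%:R)); last first.
    by apply: expR_ge1Dxn; rewrite exprn_ge0// ltW.
  rewrite -[leLHS]add0r lerD// ler_pM2r ?invr_gt0 ?ltr0n ?fact_gt0//.
  by rewrite -exprM; apply: ler_weXn2l => //; rewrite mulSn mul1n leq_addr.
apply: (@le_trans _ _ (y ^+ m / expR (y ^+ 2))).
  rewrite ler_pdivrMr// ler_peMr ?ler1n// divr_ge0 ?expR_ge0 ?exprn_ge0 ?ltW//.
rewrite ler_pdivrMr ?expR_gt0// -mulrA mulrC -mulrA.
rewrite [leRHS]mulrC.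
move: le1; rewrite ler_pdivrMr ?ltr0n ?fact_gt0// exprSr => le1.
by rewrite ler_pdivlMr// (le_trans le1)// mulrC.
Unshelve. all: by end_near. Qed.

Lemma integral_gauss_moment k :
  (\int[mu]_(x in `[0%R, +oo[) (x ^+ (2 * k) * gauss_fun x)%:E =
   (gauss_moment k)%:E)%E.
Proof.
have M_cvg j :
  (\int[mu]_(x in `[0%R, n%:R]) (x ^+ (2 * j) * gauss_fun x)%:E @[n --> \oo] -->
  \int[mu]_(x in `[0%R, +oo[) (x ^+ (2 * j) * gauss_fun x)%:E)%E.
  apply: ge0_cvgn_integral => [x|].
    by rewrite mulr_ge0 ?gauss_fun_ge0// exprM exprn_ge0 ?sqr_ge0.
  by apply: measurable_funM => //; exact: measurable_gauss_fun.
elim: k => [|k ih].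
  rewrite /gauss_moment muln0 fact0 expr0 mulr1 divr1 mul1r -integral0y_gauss.
  by apply: eq_integral => x _; rewrite mul1r.
have := M_cvg k; rewrite ih => Mk.
have : ((- ((n%:R : R) ^+ (2 * k).+1 * gauss_fun (n%:R : R) / 2))%:E +
   ((2 * k).+1%:R / 2)%:E *
     \int[mu]_(x in `[0%R, n%:R]) (x ^+ (2 * k) * gauss_fun x)%:E @[n --> \oo] -->
   (- 0)%:E + ((2 * k).+1%:R / 2)%:E * (gauss_moment k)%:E)%E.
  apply: cvgeD; first by rewrite fin_num_adde_defl.
    by apply: cvg_EFin; [near=> n|apply: cvgN; exact: expr_gauss_cvg0].
  by apply: cvgeZl.
rewrite oppr0 add0e -EFinM => H.
have -> : gauss_moment k.+1 = (2 * k).+1%:R / 2 * gauss_moment k.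
  rewrite /gauss_moment mulnSr addn2 !factS !natrM exprS.
  have f0 m : m`!%:R != 0 :> R by rewrite pnatr_eq0 -lt0n fact_gt0.
  by field; rewrite f0 expf_neq0//= nat1r pnatr_eq0.
apply: (cvg_unique _ (M_cvg k.+1)) => //.
apply: cvg_trans H; apply: near_eq_cvg; near=> n.
by rewrite gauss_moment_parts//; near: n; exact: nbhs_infty_gt.
Unshelve. all: by end_near. Qed.

Lemma sqr_powRM (y : R) k : 0 < y ->
  (y ^+ 2) `^ ((2 * k + 1)%:R / 2 - 1) * (2 * y) = 2 * y ^+ (2 * k).
Proof.
move=> y0; rewrite mulrCA; congr (2 * _).
rewrite -powR_mulrn 1?ltW// -powRrM -{2}(@powRr1 _ y) 1?ltW//.
rewrite -powRD; last by rewrite (gt_eqF y0) implybT.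
rewrite -powR_mulrn 1?ltW//; congr (_ `^ _).
by rewrite natrD natrM; field.
Qed.

(** The substitution x = y ^ 2 turns the Gamma integral at k + 1/2 into twice the
    Gaussian moment of order 2 k. *)
Lemma Gamma_half_odd k :
  Gamma ((2 * k + 1)%:R / 2 : R) = (2 * k)`!%:R / (4 ^+ k * k`!%:R) * Num.sqrt pi.
Proof.
rewrite /Gamma /Rintegral ge0_integral_sqr; last 2 first.
- apply/measurable_EFinP/measurable_funTS; apply: measurable_funM.
    exact: measurable_powR.
  by apply: measurableT_comp => //; exact: measurableT_comp.
- by move=> x _; rewrite lee_fin mulr_ge0 ?powR_ge0 ?expR_ge0.
transitivity (fine (\int[mu]_(x in `]0%R, +oo[)
    (2%:E * (x ^+ (2 * k) * gauss_fun x)%:E)%E)).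
  congr fine; apply: eq_integral => x /[!inE]/=; rewrite in_itv/= andbT => x0.
  by rewrite -!EFinM mulrAC sqr_powRM// mulrA.
have mg : measurable_fun setT (fun x : R => x ^+ (2 * k) * gauss_fun x).
  by apply: measurable_funM => //; exact: measurable_gauss_fun.
rewrite ge0_integralZl//=; last 2 first.
- exact/measurable_EFinP/measurable_funTS.
- move=> x _; rewrite lee_fin mulr_ge0 ?gauss_fun_ge0// exprM exprn_ge0//.
  exact: sqr_ge0.
rewrite integral_itv_obnd_cbnd; last first.
  by apply/measurable_EFinP; apply: measurable_funTS; exact: mg.
by rewrite integral_gauss_moment -EFinM /= /gauss_moment mulrCA [2 * _]mulrC divfK.
Qed.

(** In this form the factor k! 2 ^ k cancels the Poisson weight of index k and
    leaves the factorial (2 k)! of the cosh series. *)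
Lemma chi2_pdf_odd k (x : R) : 0 < x ->
  chi2_pdf (2 * k + 1) x = normal_peak (1 : R) * (k`!%:R * 2 ^+ k / (2 * k)`!%:R)
    * (x ^+ k / Num.sqrt x * expR (- x / 2)).
Proof.
move=> x0; rewrite /chi2_pdf Gamma_half_odd.
have -> : 2 `^ ((2 * k + 1)%:R / 2) = 2 ^+ k * Num.sqrt 2 :> R.
  rewrite -powR_mulrn// -powR12_sqrt// -powRD; last by rewrite pnatr_eq0 implybT.
  by congr (_ `^ _); rewrite natrD natrM; field.
have -> : x `^ ((2 * k + 1)%:R / 2 - 1) = x ^+ k / Num.sqrt x.
  rewrite -powR_mulrn ?ltW// -powR12_sqrt ?ltW// -powRN -powRD; last first.
    by rewrite (gt_eqF x0) implybT.
  by congr (_ `^ _); rewrite natrD natrM; field.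
have -> : normal_peak (1 : R) = (Num.sqrt pi * Num.sqrt 2)^-1.
  by rewrite /normal_peak expr1n mul1r -[pi *+ 2]mulr_natr sqrtrM ?pi_ge0.
have f0 m : m`!%:R != 0 :> R by rewrite pnatr_eq0 -lt0n fact_gt0.
have s0 (z : R) : 0 < z -> Num.sqrt z != 0 by move=> z0; rewrite gt_eqF// sqrtr_gt0.
have -> : 4 ^+ k = 2 ^+ k * 2 ^+ k :> R by rewrite -exprMn; congr (_ ^+ _); ring.
have a0 : 2 ^+ k != 0 :> R by rewrite expf_neq0.
have sx := s0 _ x0; have s2 : Num.sqrt 2 != 0 :> R by apply: s0.
have sp := s0 _ (pi_gt0 R); have fk := f0 k; have f2k := f0 (2 * k)%N.
move: (2 ^+ k) (Num.sqrt x) (Num.sqrt 2) (Num.sqrt pi) (k`!%:R) ((2 * k)`!%:R)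
  (x ^+ k) (expR _) a0 sx s2 sp fk f2k => a sx s2 sp fk f2k xk e *.
by field; do ?[apply/andP; split].
Qed.

Lemma chi2_pdf_ge0 k (x : R) : 0 < x -> 0 <= chi2_pdf (2 * k + 1) x.
Proof.
move=> x0; rewrite chi2_pdf_odd// !mulr_ge0 ?invr_ge0 ?normal_peak_ge0 ?expR_ge0//.
by rewrite exprn_ge0// ltW.
Qed.

Lemma measurable_chi2_pdf k : measurable_fun [set: R] (chi2_pdf k).
Proof.
apply: measurable_funM; last first.
  by apply: measurableT_comp => //; exact: measurable_funM.
by apply: measurable_funM => //; exact: measurable_powR.
Qed.

End HalfIntegerGamma.

(** * The law of a squared normal variable *)

Section SquaredNormal.
Variable R : realType.
Notation mu := (@lebesgue_measure R).

(** The density on the positive half-line of the square of a normal variable with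
    mean delta and variance 1: both square roots of x contribute, with Jacobian
    1 / (2 sqrt x). *)
Definition sqr_normal_pdf (delta x : R) : R :=
  (normal_pdf delta 1 (Num.sqrt x) + normal_pdf delta 1 (- Num.sqrt x))
  / (2 * Num.sqrt x).

Lemma sqr_normal_pdf_ge0 (delta x : R) : 0 <= sqr_normal_pdf delta x.
Proof. by rewrite divr_ge0 ?addr_ge0 ?normal_pdf_ge0 ?mulr_ge0 ?sqrtr_ge0. Qed.

Lemma measurable_sqr_normal_pdf (delta : R) :
  measurable_fun (`]0, +oo[%classic : set R) (sqr_normal_pdf delta).
Proof.
apply: open_continuous_measurable_fun; first exact: interval_open.
move=> x; rewrite inE/= in_itv/= andbT => x0.
have cs : {for x, continuous (@Num.sqrt R)} by exact: sqrt_continuous.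
have cn := @continuous_normal_pdf R delta 1 (oner_neq0 _).
apply: cvgM.
  apply: cvgD; first by apply: continuous_comp cs _; exact: cn.
  apply: (@continuous_comp _ _ _ (fun x => - Num.sqrt x) (normal_pdf delta 1)).
    exact: cvgN.
  exact: cn.
apply: cvgV; first by rewrite mulf_neq0// gt_eqF// sqrtr_gt0.
by apply: cvgM => //; exact: cvg_cst.
Qed.

(** The noncentral chi-squared density with one degree of freedom is a Poisson
    mixture of central ones: the left-hand side is a common factor times the
    series of cosh (delta sqrt x), and completing the squares in
    (sqrt x - delta) ^ 2 and (- sqrt x - delta) ^ 2 gives the right-hand side. *)
Lemma nneseries_chi2_mixture (delta x : R) : 0 < x ->
  ((expR (- delta ^+ 2 / 2))%:E *
   \sum_(0 <= k <oo) ((delta ^+ 2 / 2) ^+ k / k`!%:R * chi2_pdf (2 * k + 1) x)%:E =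
   (sqr_normal_pdf delta x)%:E)%E.
Proof.
move=> x0.
have s0 : 0 < Num.sqrt x by rewrite sqrtr_gt0.
have xE : x = Num.sqrt x ^+ 2 by rewrite sqr_sqrtr// ltW.
pose C := normal_peak (1 : R) / Num.sqrt x * expR (- x / 2).
have C0 : 0 <= C by rewrite mulr_ge0 ?expR_ge0// divr_ge0 ?normal_peak_ge0// ltW.
transitivity ((expR (- delta ^+ 2 / 2))%:E * (C%:E * \sum_(0 <= k <oo)
    ((delta * Num.sqrt x) ^+ (2 * k) / (2 * k)`!%:R)%:E))%E.
  congr (_ * _)%E; rewrite -nneseriesZl; last first.
    by move=> k _; rewrite lee_fin divr_ge0// exprM exprn_ge0// sqr_ge0.
  apply: eq_eseriesr => k _; rewrite -EFinM chi2_pdf_odd//; congr EFin.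
  rewrite /C exprM [(delta * _) ^+ 2]exprMn -xE expr_div_n [(delta ^+ 2 * x) ^+ k]exprMn.
  have f0 m : m`!%:R != 0 :> R by rewrite pnatr_eq0 -lt0n fact_gt0.
  have a0 : 2 ^+ k != 0 :> R by rewrite expf_neq0.
  have sx : Num.sqrt x != 0 by rewrite gt_eqF.
  have := f0 (2 * k)%N; have := f0 k.
  move: (2 ^+ k) (Num.sqrt x) ((2 * k)`!%:R) (k`!%:R) (x ^+ k)
    ((delta ^+ 2) ^+ k) (expR _) (normal_peak _) a0 sx => a s f g y d e np *.
  by field; do ?[apply/andP; split].
rewrite nneseries_cosh -!EFinM; congr EFin.
rewrite /sqr_normal_pdf !normal_pdfE ?oner_neq0// /normal_fun.
have -> : - (Num.sqrt x - delta) ^+ 2 / (1 ^+ 2 *+ 2) =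
    - delta ^+ 2 / 2 - x / 2 + delta * Num.sqrt x.
  by rewrite {2}xE; field.
have -> : - (- Num.sqrt x - delta) ^+ 2 / (1 ^+ 2 *+ 2) =
    - delta ^+ 2 / 2 - x / 2 - delta * Num.sqrt x.
  by rewrite {2}xE; field.
rewrite !expRD /C !mulNr.
by field; rewrite gt_eqF.
Qed.

(** Changing the sign of delta exchanges the two square roots. *)
Lemma sqr_normal_pdf_norm (delta x : R) :
  sqr_normal_pdf `|delta| x = sqr_normal_pdf delta x.
Proof.
have [d0|d0] := leP 0 delta; first by rewrite ger0_norm.
have pdfN y : normal_pdf (- delta) 1 y = normal_pdf delta 1 (- y).
  rewrite !normal_pdfE ?oner_neq0// /normal_fun.
  by have -> : - (y - - delta) ^+ 2 = - (- y - delta) ^+ 2 by ring.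
by rewrite ltr0_norm// /sqr_normal_pdf !pdfN opprK [X in X / _]addrC.
Qed.

(** Shift by delta, fold the negative half-line onto the positive one, and
    substitute x = y ^ 2. *)
Lemma integral_sqr_normal (delta : R) (A : set R) : measurable A ->
  (\int[mu]_(x in (fun x => (x + delta) ^+ 2)%R @^-1` A) (normal_pdf 0 1 x)%:E =
   \int[mu]_(x in A `&` `]0%R, +oo[) (sqr_normal_pdf delta x)%:E)%E.
Proof.
move=> mA.
pose S : set R := (fun x => x ^+ 2) @^-1` A.
have mS : measurable S.
  by rewrite -[S]setTI; exact: (exprn_measurable 2 measurableT).
pose f : R -> \bar R := (fun x => (normal_pdf delta 1 x)%:E) \_ S.
have mf : measurable_fun setT f.
  apply/(measurable_restrictT _ _).1 => //; apply/measurable_EFinP.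
  by apply: measurable_funTS; exact: measurable_normal_pdf.
have f0 x : (0 <= f x)%E.
  by rewrite /f patchE; case: ifP => // _; rewrite lee_fin normal_pdf_ge0.
transitivity (\int[mu]_x f x)%E.
  rewrite (ge0_integral_shift delta mf f0) integral_mkcond.
  apply: eq_integral => x _; rewrite /f !patchE.
  have -> : (x + delta \in S) = (x \in (fun x => (x + delta) ^+ 2) @^-1` A).
    by apply/idP/idP => /[!inE].
  by case: ifP => // _; rewrite !normal_pdfE ?oner_neq0// /normal_fun addrK subr0.
(* The negative half-line is folded onto the positive one; the point 0 is null. *)
have -> : (\int[mu]_x f x =
    \int[mu]_(x in `]0%R, +oo[) f x + \int[mu]_(x in `]0%R, +oo[) f (- x)%R)%E.
  have mfN : measurable_fun setT (fun x : R => f (- x)).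
    by apply: measurableT_comp => //; exact: oppr_measurable.
  have -> : (\int[mu]_(x in `]0%R, +oo[) f (- x)%R = \int[mu]_(x in `]-oo, 0%R]) f x)%E.
    rewrite integral_itv_obnd_cbnd; last by apply: measurable_funTS; exact: mfN.
    rewrite (ge0_integration_by_substitution0 mfN) => [|x]; last exact: f0.
    by apply: eq_integral => x _; rewrite opprK.
  rewrite -ge0_integral_setU//=.
  - by rewrite setUC -itv_bndbnd_setU// set_itvE.
  - by apply: measurable_funTS; exact: mf.
  - apply/disj_setPS => x [] /=; rewrite !in_itv/= andbT => x0.
    by rewrite leNgt x0.
have mpos : measurable (`]0, +oo[%classic : set R) by [].
rewrite -ge0_integralD//; last 2 first.
- exact: measurable_funTS.
- by apply: measurable_funTS; apply: measurableT_comp => //; exact: oppr_measurable.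
rewrite setIC integral_mkcondr [RHS]ge0_integral_sqr; last 2 first.
- apply: (measurable_restrict (fun x => (sqr_normal_pdf delta x)%:E) mA mpos).1.
  apply: measurable_funS mpos _ _ => //.
  by apply/measurable_EFinP; exact: measurable_sqr_normal_pdf.
- move=> x _; rewrite patchE; case: ifP => // _.
  by rewrite lee_fin sqr_normal_pdf_ge0.
apply: eq_integral => x /[!inE]/=; rewrite in_itv/= andbT => x0.
rewrite /f !patchE.
have [AxS|AxS] := pselect (A (x ^+ 2)); last first.
  by rewrite !memNset ?mul0e ?adde0 /S /= ?sqrrN.
rewrite !mem_set/S /= ?sqrrN// -EFinD -EFinM /sqr_normal_pdf.
rewrite sqrtr_sqr gtr0_norm// divfK//.
by rewrite mulf_neq0// gt_eqF.
Qed.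
End SquaredNormal.

(** * The weights and the mixture *)

Section Weights.
Variables (R : realType) (p q : nat -> R) (t0 : \bar R).
Hypothesis p_ge0 : forall n, 0 <= p n.
Hypothesis q_ge0 : forall n, 0 <= q n.
Hypothesis u_cvg : forall t, dom t0 t -> cvgn (fun m => \sum_(1 <= n < m) p n * t ^+ n).
Hypothesis v_cvg : forall t, dom t0 t -> cvgn (fun m => \sum_(0 <= n < m) q n * t ^+ n).
Hypothesis p0 : p 0%N = 0.
Hypothesis v_neq0 : exists2 t, dom t0 t & v q t != 0.

Lemma nneseries_u t : dom t0 t ->
  (\sum_(0 <= n <oo) (p n * t ^+ n)%:E = (u p t)%:E)%E.
Proof.
move=> dt; apply/cvg_lim => //; under eq_fun do rewrite sumEFin.
apply: cvg_EFin; first by near=> n.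
have -> : fine \o (fun m => (\sum_(0 <= n < m) p n * t ^+ n)%:E) =
    (fun m => \sum_(1 <= n < m) p n * t ^+ n).
  apply/funext => -[|m] /=; first by rewrite !big_geq.
  by rewrite big_ltn// p0 mul0r add0r.
exact: u_cvg.
Unshelve. all: by end_near. Qed.

Lemma nneseries_v t : dom t0 t ->
  (\sum_(0 <= n <oo) (q n * t ^+ n)%:E = (v q t)%:E)%E.
Proof.
move=> dt; apply/cvg_lim => //; under eq_fun do rewrite sumEFin.
by apply: cvg_EFin; [near=> n|exact: v_cvg].
Unshelve. all: by end_near. Qed.

(** If v vanished at some theta > 0, all the q n would, and v with them. *)
Lemma v_gt0 theta : 0 < theta -> (theta%:E < t0)%E -> 0 < v q theta.
Proof.
move=> th0 tht; have dth : dom t0 theta by split => //; exact: ltW.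
have term_ge0 n : (0 <= (q n * theta ^+ n)%:E)%E.
  by rewrite lee_fin mulr_ge0// exprn_ge0// ltW.
have le n : q n * theta ^+ n <= v q theta.
  rewrite -lee_fin -nneseries_v// (@nneseriesD1 _ _ n)// leeDl//.
  exact: nneseries_ge0.
rewrite lt_neqAle (le_trans _ (le 0%N)) ?andbT//; last by rewrite expr0 mulr1.
apply/eqP => v0; case: v_neq0 => t dt /negP; apply; apply/eqP.
have q0 n : q n = 0.
  apply/eqP; rewrite eq_le q_ge0 andbT.
  by move: (le n); rewrite -v0 pmulr_lle0// exprn_gt0.
rewrite /v (_ : (fun _ => _) = cst 0) ?lim_cst//; apply/funext => m.
by rewrite big1// => n _; rewrite q0 mul0r.
Qed.

Lemma b_ge0 n : 0 <= b p q n.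
Proof. by apply: sumr_ge0 => k _; exact: coef_ge0. Qed.

Lemma w_ge0 theta n : 0 < theta -> (theta%:E < t0)%E -> 0 <= w p q theta n.
Proof.
move=> th0 tht; rewrite /w !mulr_ge0 ?b_ge0 ?expR_ge0 ?invr_ge0 ?exprn_ge0 ?(ltW th0)//.
exact/ltW/v_gt0.
Qed.

Lemma w_support theta : 0 < theta -> (theta%:E < t0)%E ->
  pmf_support (w p q theta) = B p q.
Proof.
move=> th0 tht; apply/seteqP; split=> n; rewrite /pmf_support /B /= /w.
  apply: contra_neqT; rewrite -leNgt => b0.
  by rewrite (@le_anti _ _ (b p q n) 0) ?mulr0 ?mul0r// b0 b_ge0.
move=> b0; rewrite !mulf_neq0 ?invr_neq0//.
- by rewrite gt_eqF// v_gt0.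
- by rewrite gt_eqF// expR_gt0.
- by rewrite gt_eqF.
- by rewrite expf_neq0// gt_eqF.
Qed.

Lemma nneseries_w (theta : R) (G : nat -> R) : 0 < theta -> (theta%:E < t0)%E ->
  (forall k, 0 <= G k) ->
  (\sum_(0 <= n <oo) ((v q theta)^-1 * expR (- u p theta ^+ 2 / 2) *
     ((\sum_(0 <= k < (n %/ 2).+1) coef p q n k * G k) * theta ^+ n))%:E =
   (expR (- u p theta ^+ 2 / 2))%:E *
     \sum_(0 <= k <oo) ((u p theta ^+ 2 / 2) ^+ k / k`!%:R * G k)%:E)%E.
Proof.
move=> th0 tht G0; have dth : dom t0 theta by split => //; exact: ltW.
have H := nneseries_coef p0 p_ge0 q_ge0 (ltW th0) G0 (nneseries_u dth) (nneseries_v dth).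
under eq_eseriesr do rewrite EFinM.
rewrite nneseriesZl; last first.
  move=> n _; rewrite lee_fin mulr_ge0 ?exprn_ge0 ?(ltW th0)//.
  by apply: sumr_ge0 => k _; apply: mulr_ge0 => //; exact: coef_ge0.
have vn0 : v q theta != 0 by rewrite gt_eqF// v_gt0.
by rewrite H muleA -EFinM mulrAC mulVf// mul1r.
Qed.

Lemma is_pmf_w theta : 0 < theta -> (theta%:E < t0)%E -> is_pmf (w p q theta).
Proof.
move=> th0 tht; split=> [n|]; first exact: w_ge0.
transitivity ((expR (- u p theta ^+ 2 / 2))%:E *
     \sum_(0 <= k <oo) ((u p theta ^+ 2 / 2) ^+ k / k`!%:R * 1)%:E)%E.
  rewrite -(nneseries_w th0 tht)//; apply: eq_eseriesr => n _; congr EFin.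
  rewrite /w /b mulrA; congr (_ * _ * _).
  by apply: eq_bigr => k _; rewrite mulr1.
under eq_eseriesr do rewrite mulr1.
by rewrite nneseries_exp -EFinM -expRD mulNr addNr expR0.
Qed.

Lemma h_ge0 n (x : R) : 0 < x -> 0 <= h p q n x.
Proof.
move=> x0; rewrite mulr_ge0 ?invr_ge0 ?b_ge0//; apply: sumr_ge0 => k _.
by apply: mulr_ge0; [exact: coef_ge0|exact: chi2_pdf_ge0].
Qed.

Lemma measurable_h n : measurable_fun [set: R] (h p q n).
Proof.
apply: measurable_funM => //; apply: measurable_sum => k.
by apply: measurable_funM => //; exact: measurable_chi2_pdf.
Qed.

(** When b n = 0 both sides of the termwise comparison vanish: the coefficients
    of index n are nonnegative with sum b n, so that dividing by b n in [h] loses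
    nothing. *)
Lemma nneseries_wh (theta x : R) : 0 < theta -> (theta%:E < t0)%E -> 0 < x ->
  (\sum_(0 <= n <oo) (w p q theta n * h p q n x)%:E =
   (sqr_normal_pdf (u p theta) x)%:E)%E.
Proof.
move=> th0 tht x0.
rewrite -nneseries_chi2_mixture// -(nneseries_w th0 tht); last first.
  by move=> k; exact: chi2_pdf_ge0.
apply: eq_eseriesr => n _; congr EFin; rewrite /w /h.
have [b0|b0] := eqVneq (b p q n) 0; last by field; rewrite b0 gt_eqF ?v_gt0.
rewrite b0 mulr0 !mul0r big_nat big1 ?mul0r ?mulr0// => k /andP[_ kn].
suff -> : coef p q n k = 0 by rewrite mul0r.
apply/eqP; rewrite eq_le coef_ge0// andbT -b0 /b.
rewrite (bigD1_seq k) ?iota_uniq//= ?mem_index_iota ?kn// lerDl.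
by apply: sumr_ge0 => i _; exact: coef_ge0.
Qed.

Variables (d : measure_display) (T : measurableType d) (P : probability T R).
Variables (Y : nat -> {RV P >-> R}) (N : {RV P >-> nat}).
Variable theta : R.
Hypothesis theta_gt0 : 0 < theta.
Hypothesis theta_lt : (theta%:E < t0)%E.
Hypothesis Yh : forall n, B p q n -> has_density_pos (Y n) (h p q n).
Hypothesis NB : forall y, B p q (N y).
Hypothesis Nw : has_pmf N (w p q theta).
Hypothesis NY : indep_of_family N (B p q) Y.

Let mixture_preimage (A : set R) : (fun y => Y (N y) y) @^-1` A =
  \bigcup_n (N @^-1` [set n] `&` Y n @^-1` A).
Proof.
apply/seteqP; split=> y /=; first by move=> YA; exists (N y).
by move=> [n _ [/= <-]].
Qed.

Let measurable_piece (A : set R) n : measurable A ->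
  measurable (N @^-1` [set n] `&` Y n @^-1` A).
Proof. by move=> mA; apply: measurableI; exact: measurable_funPTI. Qed.

Lemma measurable_mixture : measurable_fun setT (fun y => Y (N y) y).
Proof.
move=> _ A mA; rewrite setTI mixture_preimage.
by apply: bigcupT_measurable => n; exact: measurable_piece.
Qed.

(** Independence factorizes the probability of the piece where N = n.  For n
    outside of the support both sides are 0: N never takes the value n, and the
    weight is 0. *)
Lemma mixture_piece (A : set R) n : measurable A ->
  (P (N @^-1` [set n] `&` Y n @^-1` A) =
   \int[lebesgue_measure]_(x in A `&` `]0%R, +oo[)
     (w p q theta n * h p q n x)%:E)%E.
Proof.
move=> mA.
have [Bn|nBn] := pselect (B p q n); last first.
  rewrite integral0_eq; last first.
    move=> x _; have : ~ pmf_support (w p q theta) n by rewrite w_support.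
    by move=> /negP; rewrite negbK => /eqP ->; rewrite mul0r.
  rewrite (_ : _ `&` _ = set0) ?measure0//; apply/seteqP; split=> // y [/= Ny _].
  by apply: nBn; rewrite -Ny; exact: NB.
rewrite NY; last 2 first.
- by exists [set n] => //; rewrite setTI.
- by apply: sub_sigma_algebra; exists n => //; exists A => //; rewrite setTI.
have mA0 : measurable (A `&` `]0%R, +oo[) by exact: measurableI.
under eq_integral do rewrite EFinM.
rewrite ge0_integralZl//; last 3 first.
- by apply/measurable_EFinP; apply: measurable_funTS; exact: measurable_h.
- by move=> x [_ /=]; rewrite in_itv/= andbT => x0; rewrite lee_fin h_ge0.
- by rewrite lee_fin w_ge0.
by congr (_ * _)%E; [exact: Nw|exact: Yh].
Qed.

Lemma mixture_distribution (A : set R) : measurable A ->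
  (pushforward P (fun y => Y (N y) y) A =
   \int[lebesgue_measure]_(x in A `&` `]0%R, +oo[)
     (sqr_normal_pdf (u p theta) x)%:E)%E.
Proof.
move=> mA; rewrite /pushforward mixture_preimage measure_bigcup//=; last 2 first.
- by move=> n _; exact: measurable_piece.
- by move=> i j _ _ [y [[/= <- _] [/= <- _]]].
transitivity (\sum_(0 <= n <oo) \int[lebesgue_measure]_(x in A `&` `]0%R, +oo[)
     (w p q theta n * h p q n x)%:E)%E.
  rewrite (@eq_eseriesl _ _ xpredT); last by move=> n; rewrite in_setT.
  by apply: eq_eseriesr => n _; exact: mixture_piece.
rewrite -integral_nneseries//=; last 3 first.
- exact: measurableI.
- move=> n; apply/measurable_EFinP; apply: measurable_funTS.
  by apply: measurable_funM => //; exact: measurable_h.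
- move=> n x [_ /=]; rewrite in_itv/= andbT => x0.
  by rewrite lee_fin mulr_ge0 ?h_ge0// w_ge0.
apply: eq_integral => x /[!inE]/= -[_]; rewrite in_itv/= andbT => x0.
exact: nneseries_wh.
Qed.

End Weights.

Theorem theorem5 (R : realType) (p q : nat -> R) (t0 : \bar R)
  (p_ge0 : forall n, 0 <= p n)
  (q_ge0 : forall n, 0 <= q n)
  (t0_gt0 : (0 < t0)%E)
  (u_cvg : forall t, dom t0 t -> cvgn (fun m => \sum_(1 <= n < m) p n * t ^+ n))
  (v_cvg : forall t, dom t0 t -> cvgn (fun m => \sum_(0 <= n < m) q n * t ^+ n))
  (p0 : p 0%N = 0)
  (v_neq0 : exists2 t, dom t0 t & v q t != 0)
  (u_infty : u p t @[t --> at_left_ereal t0] --> +oo) :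
  [/\ set_bij (dom t0) [set y | 0 <= y] (u p),
      forall theta : R, 0 < theta -> (theta%:E < t0)%E ->
        is_pmf (w p q theta) /\ pmf_support (w p q theta) = B p q
    & forall delta : R, delta != 0 ->
        let theta := u_inv p t0 `|delta| in
        forall (d : measure_display) (T : measurableType d)
          (P : probability T R) (X : {RV P >-> R})
          (d' : measure_display) (T' : measurableType d')
          (P' : probability T' R) (Y : nat -> {RV P' >-> R})
          (N : {RV P' >-> nat}),
        standard_normal X ->
        (forall n, B p q n -> has_density_pos (Y n) (h p q n)) ->
        (forall y, B p q (N y)) ->
        has_pmf N (w p q theta) ->
        indep_of_family N (B p q) Y ->
        eq_in_distribution P P'
          (fun x => (X x + delta) ^+ 2) (fun y => Y (N y) y)].
Proof.
have ubij := u_set_bij p_ge0 u_cvg t0_gt0 u_infty.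
split=> [//|theta th0 tht|delta delta0 theta d T P X d' T' P' Y N Xn Yh NB Nw NY].
  by split; [exact: (is_pmf_w p_ge0 q_ge0 u_cvg v_cvg p0 v_neq0)|
    exact: (w_support p_ge0 q_ge0 v_cvg v_neq0)].
have dinY : `|delta| \in [set y : R | 0 <= y] by rewrite inE/=.
have [_ _ surj] := ubij.
have u_theta : u p theta = `|delta| by apply: (surjpK (fun=> 0) surj).
have [theta_ge0 theta_lt] : dom t0 theta.
  by apply: (surjpinv_image_sub surj); exists `|delta| => //=.
have theta_gt0 : 0 < theta.
  rewrite lt_neqAle theta_ge0 andbT; apply/eqP => th0.
  by move: u_theta; rewrite -th0 u_at0 => /esym/eqP; rewrite normr_eq0 (negbTE delta0).
have mX : measurable_fun setT (fun x => (X x + delta) ^+ 2).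
  by apply: measurable_funX; exact: measurable_funD.
split=> // [|A mA]; first exact: measurable_mixture.
rewrite (mixture_distribution p_ge0 q_ge0 u_cvg v_cvg p0 v_neq0 theta_gt0
  theta_lt Yh NB Nw NY mA).
under [RHS]eq_integral do rewrite u_theta sqr_normal_pdf_norm.
rewrite -integral_sqr_normal//.
have mS : measurable ((fun x : R => (x + delta) ^+ 2) @^-1` A).
  rewrite -[X in measurable X]setTI.
  by apply: measurable_funX => //; exact: measurable_funD.
exact: (Xn _ mS).
Qed.
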